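(* Let $M=\varprojlim M_i$ be a projective limit of Banach manifolds. The limit of a projective system of Hessian structures on $\{M_i\}_{i\in\mathbb N}$ is a Hessian structure on $M=\varprojlim M_i$.
   Context: Setting. $\{(M_i,\varphi_{ji})\}$ is a projective system of smooth Banach manifolds (with smooth connecting maps $\varphi_{ji}:M_j\to M_i$ for $j\ge i$), where $M_i$ is modelled on the Banach space $\mathbb E_i$ and $\{\mathbb E_i,\rho_{ji}\}$ is a projective system of Banach spaces with continuous linear maps $\rho_{ji}:\mathbb E_j\to\mathbb E_i$ and limit the Fréchet space $\mathbb F=\varprojlim\mathbb E_i$. Every $m=(m_i)\in M=\varprojlim M_i$ is assumed to have a projective system of charts $(U_i,\varphi_i)$ of $M_i$, $m_i\in U_i$, $\varphi_{ji}(U_j)\subseteq U_i$, $\varphi_i\circ\varphi_{ji}=\rho_{ji}\circ\varphi_j$ on $U_j$, such that $U=\varprojlim U_i$ is open in $M$ and $\varphi=\varprojlim\varphi_i$ maps $U$ onto an open subset of $\mathbb F$. Such $(U,\varphi)$ are the (projective limit) charts, which make $M$ a Fréchet manifold modelled on $\mathbb F$. $L^2(\mathbb E,\mathbb E)$ is the space of continuous bilinear maps $\mathbb E\times\mathbb E\to\mathbb E$, and $\mathcal H^2(\mathbb F,\mathbb F)$ is the Fréchet space of sequences $(B_i)\in\prod_iL^2(\mathbb E_i,\mathbb E_i)$ with $B_i\circ(\rho_{ji}\times\rho_{ji})=\rho_{ji}\circ B_j$ for $j\ge i$. $\mathcal F(M)$ is the set of functions $f=\varprojlim f_i$ with $f_i:M_i\to\mathbb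 R$ smooth and $f_j=f_i\circ\varphi_{ji}$; $\mathcal G(M)$ is the set of vector fields $X=\varprojlim X_i$ with $X_i$ a smooth vector field on $M_i$ and $T\varphi_{ji}\circ X_j=X_i\circ\varphi_{ji}$. $X_\varphi$, $f_\varphi=f\circ\varphi^{-1}$ denote local representatives. A Hessian structure on a Banach manifold $N$ modelled on $\mathbb E$ is a map $H:f\mapsto Hf$ assigning to every $f\in C^\infty(N)$ a covariant 2-tensor $Hf$ such that for every chart $(U,\varphi)$ there is a smooth $\Gamma_\varphi:\varphi(U)\to L^2(\mathbb E,\mathbb E)$ with $[Hf(X,Y)]_\varphi(u)=D^2f_\varphi(u)(X_\varphi(u),Y_\varphi(u))+Df_\varphi(u).\Gamma_\varphi(u)(X_\varphi(u),Y_\varphi(u))$ for all vector fields $X,Y$. A Hessian structure on $M=\varprojlim M_i$ is defined in the same way, with $f\in\mathcal F(M)$, $X,Y\in\mathcal G(M)$, projective limit charts, and smooth $\Gamma_\varphi=\varprojlim\Gamma_{\varphi_i}:\varphi(U)\to\mathcal H^2(\mathbb F,\mathbb F)$. Hessian structures $H_i$ on $M_i$ form a projective system if in projective limit charts $\rho_{ji}\circ\Gamma_{\varphi_j}(u_j)=\Gamma_{\varphi_i}(\rho_{ji}u_j)\circ(\rho_{ji}\times\rho_{ji})$ for $j\ge i$; the limit is $Hf(X,Y)=\varprojlim H_if_i(X_i,Y_i)$. *)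

(* Defs.v *)
From HB Require Import structures.
From mathcomp Require Import all_boot all_order all_algebra.
From mathcomp Require Import all_classical all_reals all_analysis.

Set Implicit Arguments.
Unset Strict Implicit.
Unset Printing Implicit Defensive.
Import Order.TTheory GRing.Theory Num.Theory numFieldNormedType.Exports.
Local Open Scope classical_set_scope.
Local Open Scope ring_scope.

Section opnorm.
Context {R : realType} {V W : normedModType R}.
Implicit Types f g : V -> W.

Definition opnorm f : R := sup [set `|f x| | x in [set x : V | `|x| <= 1]].

(* k = 1 covers linear maps, k = 2 bilinear maps seen as maps on a product *)
Definition homog (k : nat) f := forall (l : R) x, f (l *: x) = l ^+ k *: f x.

Lemma homog0 k f : homog k.+1 f -> f 0 = 0.
Proof. by move=> hf; rewrite -(scale0r 0) hf expr0n scale0r. Qed.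

Let ball0 f : [set `|f x| | x in [set x : V | `|x| <= 1]] !=set0.
Proof. by exists `|f 0|; exists 0; rewrite //= normr0. Qed.

Lemma homog_bounded k f : homog k.+1 f -> continuous f ->
  has_ubound [set `|f x| | x in [set x : V | `|x| <= 1]].
Proof.
move=> hf cf; have f0 := homog0 hf.
have := cf 0; rewrite /continuous_at f0 => /cvgr0_norm_lt /(_ 1 ltr01).
move=> /nbhs_norm0P[r r0 fr].
have r2 : 0 < r / 2 by rewrite divr_gt0.
have r2n : r / 2 != 0 by rewrite gt_eqF.
exists ((r / 2) ^- k.+1) => _ [x /= x1 <-].
rewrite -[x](scalerK r2n) -exprVn hf normrZ [`|_ ^+ _|]gtr0_norm; last first.
  by rewrite exprn_gt0// invr_gt0.
rewrite ler_piMr ?exprn_ge0 ?invr_ge0 ?(ltW r2)//.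
apply/ltW/fr => /=; rewrite normrZ gtr0_norm//.
apply: (@le_lt_trans _ _ (r / 2 * 1)); first by rewrite ler_wpM2l ?(ltW r2).
by rewrite mulr1 ltr_pdivrMr// ltr_pMr// ltr1n.
Qed.

Lemma opnorm_ub k f x : homog k.+1 f -> continuous f -> `|x| <= 1 ->
  `|f x| <= opnorm f.
Proof.
by move=> hf cf x1; apply: ub_le_sup; [exact: homog_bounded hf cf|exists x].
Qed.

Lemma opnorm_le f (M : R) : (forall x, `|x| <= 1 -> `|f x| <= M) ->
  opnorm f <= M.
Proof. by move=> fM; apply: ge_sup => // _ [x /= x1 <-]; exact: fM. Qed.

Lemma opnormD k f g : homog k.+1 f -> continuous f -> homog k.+1 g ->
  continuous g -> opnorm (f + g) <= opnorm f + opnorm g.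
Proof.
move=> hf cf hg cg; apply: opnorm_le => x x1.
by rewrite (le_trans (ler_normD _ _))// lerD// (@opnorm_ub k).
Qed.

Lemma opnormZ k (l : R) f : homog k.+1 f -> continuous f ->
  opnorm (l *: f) = `|l| * opnorm f.
Proof.
move=> hf cf; have le (l' : R) (g : V -> W) : homog k.+1 g -> continuous g ->
    opnorm (l' *: g) <= `|l'| * opnorm g.
  move=> hg cg; apply: opnorm_le => x x1.
  by rewrite /= normrZ ler_wpM2l// (@opnorm_ub k).
have [->|l0] := eqVneq l 0.
  apply/eqP; rewrite normr0 mul0r scale0r eq_le; apply/andP; split.
    by apply: opnorm_le => x _; rewrite normr0.
  rewrite -[leLHS](@normr0 _ W) -[X in `|X| <= _]/((0 : V -> W) 0).
  apply: ub_le_sup; last by exists 0; rewrite //= normr0.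
  by exists 0 => _ [x _ <-]; rewrite normr0.
apply/eqP; rewrite eq_le le//=.
rewrite -ler_pdivlMl ?normr_gt0// -normfV -{1}[f](scalerK l0).
apply: le.
  by move=> m x; rewrite !fctE hf !scalerA mulrC.
by move=> x; apply: cvgZl_tmp; exact: cf.
Qed.

Lemma opnorm0_eq0 k f : homog k.+1 f -> continuous f -> opnorm f = 0 -> f = 0.
Proof.
move=> hf cf f0; apply/funext => x.
have [->|x0] := eqVneq x 0.
  exact: homog0 hf.
have nx0 : `|x| != 0 by rewrite normr_eq0.
rewrite -[x](scalerKV nx0) hf.
suff -> : f (`|x|^-1 *: x) = 0 by rewrite scaler0.
apply/eqP; rewrite -normr_le0 -f0; apply: (@opnorm_ub k) => //.
by rewrite normrZ normfV normr_id mulVf.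
Qed.

End opnorm.


(* L(V, W), normed by the operator norm *)
Section clin.
Context {R : realType} (V W : normedModType R).

Definition clin_pred : {pred V -> W} :=
  mem [set f : V -> W | linear f /\ continuous f].

Record clin := Clin { clin_fun :> V -> W; _ : clin_fun \in clin_pred }.

HB.instance Definition _ := [isSub for clin_fun].
HB.instance Definition _ := [Choice of clin by <:].

Lemma clin_submod_closed : submod_closed clin_pred.
Proof.
split=> [|l f g].
  by rewrite inE; split=> [a x y|];
    [rewrite scaler0 addr0|exact: cst_continuous].
rewrite !inE => -[lf cf] [lg cg]; split.
  move=> a x y; rewrite !fctE lf lg !scalerDr !scalerA [l * a]mulrC.
  by rewrite addrACA.
by move=> x; apply: cvgD; [apply: cvgZl_tmp; exact: cf|exact: cg].
Qed.

HB.instance Definition _ :=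
  GRing.isSubmodClosed.Build R (V -> W) clin_pred clin_submod_closed.
HB.instance Definition _ := [SubChoice_isSubLmodule of clin by <:].

Lemma clin_homog (f : clin) : homog 1 f.
Proof.
case: f => f /= /[!inE] -[lf _] l x; have f0 : f 0 = 0.
  by have := lf (-1) 0 0; rewrite !scaleN1r !addNr.
by have := lf l x 0; rewrite expr1 f0 !addr0.
Qed.

Lemma clin_continuous (f : clin) : continuous f.
Proof. by case: f => f /= /[!inE] -[]. Qed.

Let nrm (f : clin) := opnorm f.

Let nrmD (f g : clin) : nrm (f + g) <= nrm f + nrm g.
Proof.
exact: (opnormD (@clin_homog f) (@clin_continuous f)
  (@clin_homog g) (@clin_continuous g)).
Qed.

Let nrmZ l (f : clin) : nrm (l *: f) = `|l| * nrm f.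
Proof. exact: (opnormZ _ (@clin_homog f) (@clin_continuous f)). Qed.

Let nrm0 (f : clin) : nrm f = 0 -> f = 0.
Proof.
by move=> f0; apply/val_inj/(opnorm0_eq0 (@clin_homog f) (@clin_continuous f)).
Qed.

HB.instance Definition _ := @Lmodule_isNormed.Build R clin nrm nrmD nrmZ nrm0.

End clin.

(* L^2(V, W); since the norm of V * V is the max norm, the operator norm is
   the sup of |b (x, y)| over |x|, |y| <= 1 *)
Section cbil.
Context {R : realType} (V W : normedModType R).

Definition cbil_pred : {pred V * V -> W} :=
  mem [set b : V * V -> W | [/\ forall x, linear (fun y => b (x, y)),
    forall y, linear (fun x => b (x, y)) & continuous b]].

Record cbil := Cbil { cbil_fun :> V * V -> W; _ : cbil_fun \in cbil_pred }.

HB.instance Definition _ := [isSub for cbil_fun].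
HB.instance Definition _ := [Choice of cbil by <:].

Lemma cbil_submod_closed : submod_closed cbil_pred.
Proof.
split=> [|l f g].
  by rewrite inE; split=> [? a x y|? a x y|];
    [rewrite scaler0 addr0|rewrite scaler0 addr0|exact: cst_continuous].
rewrite !inE => -[lf1 lf2 cf] [lg1 lg2 cg]; split.
- move=> x a y z; rewrite !fctE lf1 lg1 !scalerDr !scalerA [l * a]mulrC.
  by rewrite addrACA.
- move=> y a x z; rewrite !fctE lf2 lg2 !scalerDr !scalerA [l * a]mulrC.
  by rewrite addrACA.
- by move=> x; apply: cvgD; [apply: cvgZl_tmp; exact: cf|exact: cg].
Qed.

HB.instance Definition _ :=
  GRing.isSubmodClosed.Build R (V * V -> W) cbil_pred cbil_submod_closed.
HB.instance Definition _ := [SubChoice_isSubLmodule of cbil by <:].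

Lemma cbil_homog (b : cbil) : homog 2 b.
Proof.
case: b => b /= /[!inE] -[lb1 lb2 _] l [x y].
have b0 z : b (0, z) = 0.
  by have := lb2 z (-1) 0 0; rewrite !scaleN1r !addNr.
have b0' z : b (z, 0) = 0.
  by have := lb1 z (-1) 0 0; rewrite !scaleN1r !addNr.
have := lb2 (l *: y) l x 0; rewrite !b0 !addr0 => ->.
by have := lb1 x l y 0; rewrite b0' !addr0 => ->; rewrite scalerA.
Qed.

Lemma cbil_continuous (b : cbil) : continuous b.
Proof. by case: b => b /= /[!inE] -[]. Qed.

Let nrm (b : cbil) := opnorm b.

Let nrmD (f g : cbil) : nrm (f + g) <= nrm f + nrm g.
Proof.
exact: (opnormD (@cbil_homog f) (@cbil_continuous f)
  (@cbil_homog g) (@cbil_continuous g)).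
Qed.

Let nrmZ l (f : cbil) : nrm (l *: f) = `|l| * nrm f.
Proof. exact: (opnormZ _ (@cbil_homog f) (@cbil_continuous f)). Qed.

Let nrm0 (f : cbil) : nrm f = 0 -> f = 0.
Proof.
by move=> f0; apply/val_inj/(opnorm0_eq0 (@cbil_homog f) (@cbil_continuous f)).
Qed.

HB.instance Definition _ := @Lmodule_isNormed.Build R cbil nrm nrmD nrmZ nrm0.

End cbil.

Section banach_smooth.
Context {R : realType}.

(* x |-> Df(x) in L(V, W); the default value 0 is only used where 'd f x is not
   continuous, in particular never where f is differentiable *)
Definition Diff (V W : normedModType R) (f : V -> W) (x : V) : clin V W :=
  insubd (0 : clin V W) ('d f x : V -> W).

Lemma DiffE (V W : normedModType R) (f : V -> W) (x : V) :
  differentiable f x -> Diff f x = 'd f x :> (V -> W).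
Proof.
move=> df; rewrite /Diff -[LHS]/(val _) insubdK// inE.
by split; [exact: linearP|exact: diff_continuous].
Qed.

Definition Diff2 (V W : normedModType R) (f : V -> W) (u x y : V) : W :=
  ('d (Diff f) u x : clin V W) y.

(* U is meant to be open *)
Fixpoint Ck (k : nat) (V W : normedModType R) (U : set V) (f : V -> W) : Prop :=
  if k is k'.+1 then
    (forall x, U x -> differentiable f x) /\ Ck k' U (Diff f)
  else forall x, U x -> {for x, continuous f}.

Definition smooth (V W : normedModType R) (U : set V) (f : V -> W) :=
  forall k, Ck k U f.

End banach_smooth.

Section frechet_smooth.
Context {R : realType} {V W : preTopologicalLmodType R}.

Definition snoc (k : nat) (v : 'I_k -> V) (h : V) : 'I_k.+1 -> V :=
  fun i => oapp v h (unlift ord_max i).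

(* Smoothness in the sense of Michal-Bastiani, Leslie and Hamilton: the iterated
   directional derivatives D k x (v_1, .., v_k) = D^k f(x)(v_1, .., v_k) exist
   and are jointly continuous on U * V^k. U is meant to be open. *)
Definition fsmooth (U : set V) (f : V -> W) :=
  exists D : forall k, V -> {ptws 'I_k -> V} -> W,
  [/\ forall x v, U x -> D 0%N x v = f x,
      forall k (p : V * {ptws 'I_k -> V}), U p.1 ->
        {for p, continuous (fun q : V * {ptws 'I_k -> V} => D k q.1 q.2)} &
      forall k x (v : 'I_k -> V) h, U x ->
        (fun t : R => t^-1 *: (D k (x + t *: h) v - D k x v)) @ 0^'
          --> D k.+1 x (snoc v h)].

End frechet_smooth.

Section frechet_derivative.
Context {R : realType} {V : preTopologicalLmodType R}.

Definition fderiv (f : V -> R) (u v : V) : R :=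
  lim ((fun t : R => t^-1 * (f (u + t *: v) - f u)) @ 0^').

Definition fderiv2 (f : V -> R) (u x y : V) : R :=
  fderiv (fun z => fderiv f z y) u x.

End frechet_derivative.

Section banach_manifolds.
Context {R : realType}.

(* cmap and cinv are only relevant on cdom and cmap @` cdom respectively *)
Record chart (N : topologicalType) (E : normedModType R) := Chart {
  cdom : set N;
  cmap : N -> E;
  cinv : E -> N;
  cdom_open : open cdom;
  cimg_open : open (cmap @` cdom);
  cmapK : forall x, cdom x -> cinv (cmap x) = x;
  cmap_continuous : {within cdom, continuous cmap};
  cinv_continuous : {within cmap @` cdom, continuous cinv} }.

Definition cimg (N : topologicalType) (E : normedModType R) (c : chart N E) :=
  cmap c @` cdom c.

Record banachManifold (E : completeNormedModType R) := BanachManifold {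
  mcarrier :> topologicalType;
  atlas : set (chart mcarrier E);
  atlas_cover : forall x, exists2 c, atlas c & cdom c x;
  atlas_smooth : forall c1 c2, atlas c1 -> atlas c2 ->
    smooth (cmap c1 @` (cdom c1 `&` cdom c2)) (cmap c2 \o cinv c1);
  atlas_maximal : forall c,
    (forall c', atlas c' ->
      smooth (cmap c @` (cdom c `&` cdom c')) (cmap c' \o cinv c) /\
      smooth (cmap c' @` (cdom c' `&` cdom c)) (cmap c \o cinv c')) ->
    atlas c }.

Definition smooth_map (E1 E2 : completeNormedModType R)
    (N1 : banachManifold E1) (N2 : banachManifold E2) (f : N1 -> N2) :=
  continuous f /\
  forall c1 c2, atlas c1 -> atlas c2 ->
    smooth (cmap c1 @` (cdom c1 `&` f @^-1` cdom c2))
           (cmap c2 \o f \o cinv c1).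

Section tangent.
Context {E : completeNormedModType R} {N : banachManifold E}.

(* A tangent vector at x, i.e. a class of pairs (c, v) with c a chart at x and
   v in E modulo change of chart, is given by its representatives c |-> v
   (extended by 0 to the charts that are not charts at x). *)
Definition tangent_pred (x : N) : {pred chart N E -> E} :=
  mem [set v : chart N E -> E |
    (forall c1 c2, atlas c1 -> atlas c2 -> cdom c1 x -> cdom c2 x ->
      v c2 = 'd (cmap c2 \o cinv c1) (cmap c1 x) (v c1)) /\
    (forall c, ~ (atlas c /\ cdom c x) -> v c = 0)].

Record tangent (x : N) := Tangent {
  trep :> chart N E -> E; _ : trep \in tangent_pred x }.

HB.instance Definition _ x := [isSub for @trep x].
HB.instance Definition _ x := [Choice of tangent x by <:].

Lemma tangent_submod_closed x : submod_closed (tangent_pred x).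
Proof.
split=> [|l v w].
  by rewrite inE; split=> // c1 c2 *; rewrite linear0.
rewrite !inE => -[v1 v2] [w1 w2]; split.
  move=> c1 c2 a1 a2 d1 d2; rewrite !fctE linearP.
  by rewrite -(v1 c1 c2)// -(w1 c1 c2).
by move=> c ac; rewrite !fctE v2// w2// scaler0 addr0.
Qed.

HB.instance Definition _ x := GRing.isSubmodClosed.Build R
  (chart N E -> E) (tangent_pred x) (tangent_submod_closed x).
HB.instance Definition _ x := [SubChoice_isSubLmodule of tangent x by <:].

End tangent.

(* T f (v) = w *)
Definition is_tangent_map (E1 E2 : completeNormedModType R)
    (N1 : banachManifold E1) (N2 : banachManifold E2) (f : N1 -> N2)
    (x : N1) (v : tangent x) (w : tangent (f x)) :=
  forall c1 c2, atlas c1 -> atlas c2 -> cdom c1 x -> cdom c2 (f x) ->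
    w c2 = 'd (cmap c2 \o f \o cinv c1) (cmap c1 x) (v c1).

Arguments is_tangent_map {E1 E2 N1 N2} f {x} v w.

Section hessian.
Context {E : completeNormedModType R} (N : banachManifold E).

Definition smooth_funs : set (N -> R) :=
  [set f | forall c, atlas c -> smooth (cimg c) ((f : N -> R^o) \o cinv c)].

Definition smooth_fields : set (forall x : N, tangent x) :=
  [set X | forall c, atlas c -> smooth (cimg c) (fun u => X (cinv c u) c)].

(* A covariant 2-tensor, as a C^oo(N)-bilinear map from pairs of vector fields
   to C^oo(N); only its values on smooth fields are relevant. *)
Definition tensor2
    (T : (forall x : N, tangent x) -> (forall x : N, tangent x) -> N -> R) :=
  [/\ forall X Y, smooth_fields X -> smooth_fields Y -> smooth_funs (T X Y),
      forall g X X' Y, smooth_funs g ->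
        smooth_fields X -> smooth_fields X' -> smooth_fields Y ->
        T (fun x => g x *: X x + X' x) Y = fun x => g x * T X Y x + T X' Y x &
      forall g X Y Y', smooth_funs g ->
        smooth_fields X -> smooth_fields Y -> smooth_fields Y' ->
        T X (fun x => g x *: Y x + Y' x) = fun x => g x * T X Y x + T X Y' x].

Definition hessian_map := (N -> R) ->
  (forall x : N, tangent x) -> (forall x : N, tangent x) -> N -> R.

(* G is the map Gamma_c of H in the chart c; the local representative of
   H f X Y is evaluated at u = cmap c x *)
Definition is_christoffel (H : hessian_map) (c : chart N E)
    (G : E -> cbil E E) :=
  smooth (cimg c) G /\
  forall f X Y, smooth_funs f -> smooth_fields X -> smooth_fields Y ->
  forall x, cdom c x ->
    let u := cmap c x in
    let fc := (f : N -> R^o) \o cinv c in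
    H f X Y x = Diff2 fc u (X x c) (Y x c) + 'd fc u (G u (X x c, Y x c)).

Definition hessian_structure (H : hessian_map) :=
  (forall f, smooth_funs f -> tensor2 (H f)) /\
  (forall c, atlas c -> exists G, is_christoffel H c G).

End hessian.

End banach_manifolds.
Arguments is_tangent_map {R E1 E2 N1 N2} f {x} v w.

(* Submodules of a countable product of normed spaces, with the topology induced
   by the product topology; both F = lim E_i and H^2(F, F) are of this form. *)
Section subproducts.
Context {R : realType} {T : nat -> normedModType R}.

Let PT := prod_topology T.

Let addP (f g : PT) : PT := fun i => f i + g i.
Let oppP (f : PT) : PT := fun i => - f i.
Let scaleP (a : R) (f : PT) : PT := fun i => a *: f i.

Let addPA : associative addP.
Proof.
by move=> f g h; apply: functional_extensionality_dep => i; exact: addrA.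
Qed.
Let addPC : commutative addP.
Proof.
by move=> f g; apply: functional_extensionality_dep => i; exact: addrC.
Qed.
Let add0P : left_id (fun i => 0 : T i) addP.
Proof.
by move=> f; apply: functional_extensionality_dep => i; exact: add0r.
Qed.
Let addNP : left_inverse (fun i => 0 : T i) oppP addP.
Proof.
by move=> f; apply: functional_extensionality_dep => i; exact: addNr.
Qed.

HB.instance Definition _ :=
  GRing.isZmodule.Build (prod_topology T) addPA addPC add0P addNP.

Let scalePA a b f : scaleP a (scaleP b f) = scaleP (a * b) f.
Proof. by apply: functional_extensionality_dep => i; exact: scalerA. Qed.
Let scale1P : left_id 1 scaleP.
Proof.
by move=> f; apply: functional_extensionality_dep => i; exact: scale1r.
Qed.
Let scalePDr : right_distributive scaleP +%R.
Proof.
by move=> a f g; apply: functional_extensionality_dep => i; exact: scalerDr.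
Qed.
Let scalePDl f : {morph scaleP^~ f : a b / a + b}.
Proof.
by move=> a b; apply: functional_extensionality_dep => i; exact: scalerDl.
Qed.

HB.instance Definition _ := GRing.Zmodule_isLmodule.Build R (prod_topology T)
  scalePA scale1P scalePDr scalePDl.

End subproducts.

Section subprod.
Context {R : realType} {T : nat -> normedModType R}.
Context {P : set (prod_topology T)}.

Record subprod (hP : submod_closed (mem P)) :=
  Subprod { spval : prod_topology T; _ : spval \in mem P }.

Definition spfun hP (x : subprod hP) : forall i, T i := spval x.

Variable hP : submod_closed (mem P).

HB.instance Definition _ := [isSub for @spval hP].
HB.instance Definition _ := [Choice of subprod hP by <:].

(* indexed by hP, so that the closure property can be inferred *)
Definition subprod_pred (_ : submod_closed (mem P)) :
  {pred prod_topology T} := mem P.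

HB.instance Definition _ := GRing.isSubmodClosed.Build R (prod_topology T)
  (subprod_pred hP) hP.
HB.instance Definition _ := GRing.SubChoice_isSubLmodule.Build R
  (prod_topology T) (subprod_pred hP) (subprod hP) hP.
HB.instance Definition _ :=
  Topological.copy (subprod hP) (initial_topology (@spval hP)).

End subprod.
Coercion spfun : subprod >-> Funclass.

Section banach_systems.
Context {R : realType}.

Record banachSystem := BanachSystem {
  bsp :> nat -> completeNormedModType R;
  rho : forall i j, (i <= j)%N -> {linear bsp j -> bsp i};
  rho_continuous : forall i j (ij : (i <= j)%N), continuous (rho ij);
  rho_id : forall i (ii : (i <= i)%N) x, rho ii x = x;
  rho_comp : forall i j k (ij : (i <= j)%N) (jk : (j <= k)%N) (ik : (i <= k)%N)
    x, rho ij (rho jk x) = rho ik x }.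

Arguments rho {b i j}.

Variable E : banachSystem.

Definition frechet_set : set (prod_topology (fun i => E i)) :=
  [set x : forall i, E i | forall i j (ij : (i <= j)%N), rho ij (x j) = x i].

Lemma frechet_submod_closed : submod_closed (mem frechet_set).
Proof.
split=> [|l x y]; first by rewrite inE => i j ij; rewrite linear0.
by rewrite !inE => hx hy i j ij; rewrite /= linearP hx hy.
Qed.

(* F = lim E_i *)
Definition frechet := subprod frechet_submod_closed.

Definition H2_set : set (prod_topology (fun i => cbil (E i) (E i))) :=
  [set B : forall i, cbil (E i) (E i) | forall i j (ij : (i <= j)%N) x y,
    B i (rho ij x, rho ij y) = rho ij (B j (x, y))].

Lemma H2_submod_closed : submod_closed (mem H2_set).
Proof.
split=> [|l A B]; first by rewrite inE => i j ij x y; rewrite linear0.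
rewrite !inE => hA hB i j ij x y.
rewrite -[LHS]/(l *: A i _ + B i _) hA hB -linearP.
by congr (rho _ _).
Qed.

(* H^2(F, F) *)
Definition H2 := subprod H2_submod_closed.

Lemma H2_app_subproof (B : H2) (x y : frechet) :
  ((fun i => B i (x i, y i)) : prod_topology (fun i => E i))
    \in mem frechet_set.
Proof.
rewrite inE => i j ij /=; case: x y B => [x /= /[!inE] hx] [y /= /[!inE] hy].
by case=> B /= /[!inE] hB; rewrite /spfun/= -hB hx hy.
Qed.

Definition H2_app (B : H2) (x y : frechet) : frechet :=
  Subprod frechet_submod_closed (H2_app_subproof B x y).

End banach_systems.
Arguments banachSystem : clear implicits.
Arguments rho {R b i j}.

Section manifold_systems.
Context {R : realType} {E : banachSystem R}.

Record manifoldSystem := ManifoldSystem {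
  msp :> forall i, banachManifold (E i);
  phi : forall i j, (i <= j)%N -> msp j -> msp i;
  phi_smooth : forall i j (ij : (i <= j)%N), smooth_map (phi ij);
  phi_id : forall i (ii : (i <= i)%N) x, phi ii x = x;
  phi_comp : forall i j k (ij : (i <= j)%N) (jk : (j <= k)%N) (ik : (i <= k)%N)
    x, phi ij (phi jk x) = phi ik x }.

Arguments phi {m i j}.

Variable M : manifoldSystem.

Definition limit_set : set (prod_topology (fun i => M i)) :=
  [set m : forall i, M i | forall i j (ij : (i <= j)%N), phi ij (m j) = m i].

(* M = lim M_i, with the topology induced by the product topology *)
Definition limit : topologicalType := set_type limit_set.

Definition mproj (i : nat) (m : limit) : M i := set_val m i.

Definition chart_family := forall i, chart (M i) (E i).

Definition lim_dom (c : chart_family) : set limit :=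
  [set m | forall i, cdom (c i) (mproj i m)].

(* the default value 0 is not used on lim_dom c for the charts defined below *)
Definition lim_map (c : chart_family) (m : limit) : frechet E :=
  insubd (0 : frechet E) (fun i => cmap (c i) (mproj i m)).

Definition lim_img (c : chart_family) := lim_map c @` lim_dom c.

Definition pl_chart_at (m : limit) (c : chart_family) :=
  [/\ forall i, atlas (c i) /\ cdom (c i) (mproj i m),
      forall i j (ij : (i <= j)%N) x, cdom (c j) x ->
        cdom (c i) (phi ij x) /\
        cmap (c i) (phi ij x) = rho ij (cmap (c j) x),
      open (lim_dom c) & open (lim_img c)].

Lemma lim_mapE (m0 m : limit) (c : chart_family) (i : nat) :
  pl_chart_at m0 c -> lim_dom c m ->
  lim_map c m i = cmap (c i) (mproj i m).
Proof.
move=> [_ cphi _ _] cm; rewrite /lim_map /spfun.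
rewrite -[spval _]/(val _) insubdK// inE => j k jk /=.
have [_ <-] := cphi j k jk (mproj k m) (cm k).
by have /set_mem -> := valP m.
Qed.

Definition has_pl_charts := forall m, exists c, pl_chart_at m c.

(* the inverse of lim_map c on lim_img c, and m elsewhere *)
Definition lim_inv (m : limit) (c : chart_family) (u : frechet E) : limit :=
  xget m [set m' | lim_dom c m' /\ lim_map c m' = u].

Definition lim_field := forall (m : limit) i, tangent (mproj i m).

Definition is_lim_fun (fs : forall i, M i -> R) (f : limit -> R) :=
  [/\ forall i, smooth_funs (fs i),
      forall i j (ij : (i <= j)%N) x, fs j x = fs i (phi ij x) &
      forall m i, f m = fs i (mproj i m)].

Definition is_lim_field (Xs : forall i (x : M i), tangent x) (X : lim_field) :=
  [/\ forall i, smooth_fields (Xs i),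
      forall i j (ij : (i <= j)%N) x,
        is_tangent_map (phi ij) (Xs j x) (Xs i (phi ij x)) &
      forall m i, X m i = Xs i (mproj i m)].

(* F(M) and G(M) *)
Definition lim_funs : set (limit -> R) := [set f | exists fs, is_lim_fun fs f].
Definition lim_fields : set lim_field := [set X | exists Xs, is_lim_field Xs X].

(* C^oo(M) for the Frechet manifold M; it contains F(M) *)
Definition frechet_smooth_funs : set (limit -> R) :=
  [set f | forall m c, pl_chart_at m c ->
    fsmooth (lim_img c) ((f : limit -> R^o) \o lim_inv m c)].

(* A covariant 2-tensor on M, as an F(M)-bilinear map on G(M). The values are
   only required to be smooth functions on M: since the projections M -> M_i
   need not be surjective, local formulas around the points of M do not control
   functions on the whole of M_i. *)
Definition lim_tensor2 (T : lim_field -> lim_field -> limit -> R) :=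
  [/\ forall X Y, lim_fields X -> lim_fields Y -> frechet_smooth_funs (T X Y),
      forall g X X' Y, lim_funs g ->
        lim_fields X -> lim_fields X' -> lim_fields Y ->
        T (fun m i => g m *: X m i + X' m i) Y =
          fun m => g m * T X Y m + T X' Y m &
      forall g X Y Y', lim_funs g ->
        lim_fields X -> lim_fields Y -> lim_fields Y' ->
        T X (fun m i => g m *: Y m i + Y' m i) =
          fun m => g m * T X Y m + T X Y' m].

Definition lim_hessian_map :=
  (limit -> R) -> lim_field -> lim_field -> limit -> R.

(* rho_ji o G_j (u_j) = G_i (rho_ji u_j) o (rho_ji x rho_ji) *)
Definition christoffel_compatible (c : chart_family)
    (G : forall i, E i -> cbil (E i) (E i)) :=
  forall i j (ij : (i <= j)%N) u, cimg (c j) u ->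
    forall x y, rho ij (G j u (x, y)) = G i (rho ij u) (rho ij x, rho ij y).

Definition is_lim_christoffel (K : lim_hessian_map) (m : limit)
    (c : chart_family) (G : frechet E -> H2 E) :=
  [/\ exists Gs : forall i, E i -> cbil (E i) (E i),
        [/\ forall i, smooth (cimg (c i)) (Gs i), christoffel_compatible c Gs &
            forall u, lim_img c u -> forall i, G u i = Gs i (u i)],
      fsmooth (lim_img c) G &
      forall f X Y, lim_funs f -> lim_fields X -> lim_fields Y ->
      forall m', lim_dom c m' ->
        let u := lim_map c m' in
        let fc := f \o lim_inv m c in
        let Xu := insubd (0 : frechet E) (fun i => X m' i (c i)) in
        let Yu := insubd (0 : frechet E) (fun i => Y m' i (c i)) in
        K f X Y m' = fderiv2 fc u Xu Yu + fderiv fc u (H2_app (G u) Xu Yu)].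

Definition lim_hessian_structure (K : lim_hessian_map) :=
  (forall f, lim_funs f -> lim_tensor2 (K f)) /\
  (forall m c, pl_chart_at m c -> exists G, is_lim_christoffel K m c G).

Definition hessian_system (H : forall i, hessian_map (M i)) :=
  (forall i, hessian_structure (H i)) /\
  (forall m c, pl_chart_at m c -> exists2 G : forall i, E i -> cbil (E i) (E i),
    forall i, is_christoffel (H i) (c i) (G i) & christoffel_compatible c G).

(* K = lim H_i : K f X Y = lim H_i f_i (X_i, Y_i) *)
Definition is_lim_hessian (H : forall i, hessian_map (M i))
    (K : lim_hessian_map) :=
  forall fs f Xs X Ys Y,
    is_lim_fun fs f -> is_lim_field Xs X -> is_lim_field Ys Y ->
  forall m i, K f X Y m = H i (fs i) (Xs i) (Ys i) (mproj i m).

End manifold_systems.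
Arguments manifoldSystem {R} E.
Arguments phi {R E m i j}.

(* Main.v *)
Require Import Defs.
From HB Require Import structures.
From mathcomp Require Import all_boot all_order all_algebra.
From mathcomp Require Import all_classical all_reals all_analysis.

(** Everything on the limit M is computed on a single level M_i.

    In a projective limit chart, a function f = lim f_i in F(M) is the composite
    of the local representative of any one f_i with the continuous linear
    projection u |-> u_i of F = lim E_i. Its first and second directional
    derivatives on F are therefore those of f_i, evaluated on i-th components
    ([fderiv_factor], [fderiv2_factor]). Feeding this into the local formula of
    H_i gives [hessian_local]: whatever the level i and whatever the systems
    (f_i), (X_i), (Y_i) representing f, X, Y, the number H_i f_i (X_i, Y_i) at
    the i-th component of m is
      D^2 f(u)(X(u), Y(u)) + D f(u) . Gamma(u)(X(u), Y(u)),
    an expression in f, X, Y alone. This is what makes the limit H well defined,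
    and it is at the same time the local formula required of H.

    The independence of the representing systems is a genuine point: the
    projections M -> M_i need not be onto, so f does not determine f_i; but the
    formula only differentiates f_i along directions coming from F.

    The rest is calculus. The axioms of a tensor are inherited from level 0, once
    G(M) is known to be stable under X |-> g X + X', which comes from the product
    rule for smooth maps between Banach spaces ([Ck_cbilin]). Smoothness on the
    Frechet space F asks for iterated directional derivatives that are jointly
    continuous; on one level they are the iterated Frechet derivatives
    ([iterated_diff_cvg], [iterated_diff_dcvg]), and a map into a projective
    limit is differentiated componentwise. The only thing to check there is that
    the sequence of derivatives of the Gamma_i stays in H^2(F, F), and it does
    because it is a limit of difference quotients and H^2(F, F) is closed in the
    product ([fsmooth_subprod], [H2_closed]). *)

Set Implicit Arguments.
Unset Strict Implicit.
Unset Printing Implicit Defensive.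
Import Order.TTheory GRing.Theory Num.Theory numFieldNormedType.Exports.
Local Open Scope classical_set_scope.
Local Open Scope ring_scope.

(** * Derivatives and bounded maps between normed spaces *)

Section diffs.
Context {R : realType}.
Implicit Types V W Z : normedModType R.

Lemma diff_dcvg V W (f : V -> W) x h : differentiable f x ->
  (fun t : R => t^-1 *: (f (x + t *: h) - f x)) @ 0^' --> 'd f x h.
Proof.
move=> df; rewrite -deriveE//.
suff -> : (fun t : R => t^-1 *: (f (x + t *: h) - f x)) =
    fun t => t^-1 *: ((f \o shift x) (t *: h) - f x).
  exact: diff_derivable.
by apply/funext => t; rewrite /= (addrC x).
Qed.

Lemma near_differentiable V W (f g : V -> W) x : (\near x, f x = g x) ->
  differentiable f x -> differentiable g x /\ 'd g x = 'd f x :> (V -> W).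
Proof.
move=> fg df; have fgx := nbhs_singleton fg.
have E : g \o shift x = cst (g x) + 'd f x +o_0 id.
  apply/eqaddoP => e e0.
  have := (diff_locallyP _ _).1 df => -[_ /eqaddoP /(_ e e0)] fo.
  have fg0 : \forall h \near (0 : V), f (h + x) = g (h + x).
    have : (shift x) @ (0 : V) --> 0 + x.
      by apply: cvgD; [exact: cvg_id|exact: cvg_cst].
    by rewrite add0r => /(_ _ fg).
  near=> h; rewrite -fgx.
  have -> : (g \o shift x - (cst (f x) + 'd f x)) h =
            (f \o shift x - (cst (f x) + 'd f x)) h.
    rewrite !fctE /=; congr (_ - _); apply/esym; near: h; exact: fg0.
  by near: h.
have dg := diff_unique (diff_continuous df) E.
have dg' : 'd g x = 'd f x :> (V -> W) by exact: dg.
split; last exact: dg'.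
apply/diff_locallyP; rewrite dg'; split; [exact: diff_continuous|exact: E].
Unshelve. all: by end_near. Qed.

Lemma clin_linear V W (l : clin V W) : linear l.
Proof. by case: l => l /= /[!inE] -[]. Qed.

(** Covers bounded linear maps (k = 0) and bounded bilinear maps, seen as
    quadratic maps on the product (k = 1). *)
Lemma homog_le V W k (f : V -> W) x : homog k.+1 f -> continuous f ->
  `|f x| <= opnorm f * `|x| ^+ k.+1.
Proof.
move=> hf cf; have [->|x0] := eqVneq x 0.
  by rewrite (homog0 hf) !normr0 expr0n mulr0.
have nx : 0 < `|x| by rewrite normr_gt0.
rewrite -ler_pdivrMr ?exprn_gt0// mulrC -[X in X * _]gtr0_norm; last first.
  by rewrite invr_gt0 exprn_gt0.
rewrite -normrZ -exprVn -hf; apply: opnorm_ub hf cf _.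
by rewrite normrZ normfV normr_id mulVf ?gt_eqF.
Qed.

Lemma clin_bound V W (l : clin V W) x : `|l x| <= `|l| * `|x|.
Proof.
have := homog_le x (@clin_homog _ _ _ l) (@clin_continuous _ _ _ l).
by rewrite expr1.
Qed.

Lemma clin_opnorm_le V W (l : clin V W) C : 0 <= C ->
  (forall x, `|l x| <= C * `|x|) -> `|l| <= C.
Proof.
move=> C0 lC; apply: opnorm_le => x x1.
by rewrite (le_trans (lC x))// ler_piMr.
Qed.

Lemma Diff_app V W (f : V -> W) x h : differentiable f x ->
  Diff f x h = 'd f x h.
Proof.
by move=> df; rewrite -[RHS](congr1 (fun l : V -> W => l h) (DiffE df)).
Qed.

Lemma Diff_eq V W (f : V -> W) x (l : clin V W) : differentiable f x ->
  (forall h, l h = 'd f x h) -> l = Diff f x.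
Proof.
by move=> df lf; apply/val_inj/funext => h; rewrite [RHS]Diff_app// -lf.
Qed.

Lemma cvg_lipschitz V W (T : Type) (F : set_system T)
    {FF : Filter F} (f : T -> W) w v (g : T -> V) (C : R) :
  (forall t, `|f t - w| <= C * `|g t - v|) -> g @ F --> v -> f @ F --> w.
Proof.
move=> fg gv; apply/subr_cvg0/norm_cvg0P/(@squeeze_cvgr _ _ _ _ (fun=> 0)
  (fun t => C * `|g t - v|)).
- by apply: nearW => t; rewrite normr_ge0/=.
- exact: cvg_cst.
- rewrite -(mulr0 C) -(@normr0 _ V) -(subrr v).
  apply: cvgM; first exact: cvg_cst.
  by apply: cvg_norm; apply: cvgB => //; exact: cvg_cst.
Qed.

(** * Bounded bilinear maps and the product rule *)

(** Three different spaces are needed, since the product rule is proved by an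
    induction in which the source spaces become spaces of linear maps. *)
Record cbilin (V W Z : normedModType R) := CBilin {
  cbfun :> V -> W -> Z;
  cbfunDl : forall w, linear (cbfun ^~ w);
  cbfunDr : forall v, linear (cbfun v);
  cbfun_bound : exists2 C, 0 <= C &
    forall v w, `|cbfun v w| <= C * `|v| * `|w| }.

HB.instance Definition _ V W Z (B : cbilin V W Z) :=
  bilinear_isBilinear.Build R V W Z _ _ (cbfun B)
    (@cbfunDl _ _ _ B, @cbfunDr _ _ _ B).

Lemma cbilin_cvg V W Z (B : cbilin V W Z) (T : Type) (F : set_system T)
    {FF : Filter F} (f : T -> V) (g : T -> W) v w :
  f @ F --> v -> g @ F --> w -> (fun t => B (f t) (g t)) @ F --> B v w.
Proof.
move=> fv gw; have [C C0 BC] := cbfun_bound B.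
apply/subr_cvg0/norm_cvg0P/(@squeeze_cvgr _ _ _ _ (fun=> 0) (fun t =>
  C * `|f t - v| * `|g t| + C * `|v| * `|g t - w|)).
- apply: nearW => t; rewrite normr_ge0/=.
  have -> : B (f t) (g t) - B v w = B (f t - v) (g t) + B v (g t - w).
    by rewrite linearBl linearBr addrA subrK.
  by rewrite (le_trans (ler_normD _ _))// lerD.
- exact: cvg_cst.
- have -> : 0 = C * `|v - v| * `|w| + C * `|v| * `|w - w|.
    by rewrite !subrr !normr0 !mulr0 mul0r addr0.
  apply: cvgD; apply: cvgM; [|exact: cvg_norm|exact: cvg_cst|].
    apply: cvgM; [exact: cvg_cst|apply: cvg_norm; apply: cvgB => //].
    exact: cvg_cst.
  by apply: cvg_norm; apply: cvgB => //; exact: cvg_cst.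
Qed.

Lemma cbilin_continuous V W Z (B : cbilin V W Z) :
  continuous (fun p : V * W => B p.1 p.2).
Proof. move=> p; apply: cbilin_cvg; [exact: cvg_fst|exact: cvg_snd]. Qed.

Lemma diff_cbilin V W Z (B : cbilin V W Z) (U : normedModType R)
    (f : U -> V) (g : U -> W) x : differentiable f x -> differentiable g x ->
  differentiable (fun u => B (f u) (g u)) x /\
  'd (fun u => B (f u) (g u)) x =
    (fun h => B ('d f x h) (g x) + B (f x) ('d g x h)) :> (U -> Z).
Proof.
move=> df dg; have cB := @cbilin_continuous _ _ _ B.
have dfg := differentiable_pair df dg.
have dB := differentiable_bilin (f := B) (f x, g x) cB.
split; first exact: (differentiable_comp dfg dB).
have := diff_comp dfg dB; rewrite /= => ->.
rewrite (diff_bilin (f x, g x) cB) diff_pair//.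
by apply/funext => h /=; rewrite addrC.
Qed.

Section cbilin_compose.
Context {U V W Z : normedModType R}.
Variable B : cbilin V W Z.

Lemma cbilinl_subproof (l : clin U V) (w : W) :
  (fun h => B (l h) w) \in @clin_pred R U Z.
Proof.
rewrite inE; split=> [a x y|x].
  by rewrite clin_linear cbfunDl.
by apply: cbilin_cvg; [exact: clin_continuous|exact: cvg_cst].
Qed.

Lemma cbilinr_subproof (v : V) (l : clin U W) :
  (fun h => B v (l h)) \in @clin_pred R U Z.
Proof.
rewrite inE; split=> [a x y|x].
  by rewrite clin_linear cbfunDr.
by apply: cbilin_cvg; [exact: cvg_cst|exact: clin_continuous].
Qed.

Definition cbilinl_fun l w : clin U Z := Clin (cbilinl_subproof l w).
Definition cbilinr_fun v l : clin U Z := Clin (cbilinr_subproof v l).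

Lemma cbilinl_linearl w : linear (cbilinl_fun ^~ w).
Proof. by move=> a x y; apply/val_inj/funext => h /=; rewrite cbfunDl. Qed.
Lemma cbilinl_linearr l : linear (cbilinl_fun l).
Proof. by move=> a x y; apply/val_inj/funext => h /=; rewrite cbfunDr. Qed.
Lemma cbilinr_linearl l : linear (cbilinr_fun ^~ l).
Proof. by move=> a x y; apply/val_inj/funext => h /=; rewrite cbfunDl. Qed.
Lemma cbilinr_linearr v : linear (cbilinr_fun v).
Proof. by move=> a x y; apply/val_inj/funext => h /=; rewrite cbfunDr. Qed.

Lemma cbilinl_bound :
  exists2 C, 0 <= C & forall l w, `|cbilinl_fun l w| <= C * `|l| * `|w|.
Proof.
have [C C0 BC] := cbfun_bound B; exists C => // l w.
apply: clin_opnorm_le => [|h]; first by rewrite !mulr_ge0.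
rewrite (le_trans (BC _ _))// [leRHS]mulrAC ler_wpM2r// -mulrA ler_wpM2l//.
exact: clin_bound.
Qed.

Lemma cbilinr_bound :
  exists2 C, 0 <= C & forall v l, `|cbilinr_fun v l| <= C * `|v| * `|l|.
Proof.
have [C C0 BC] := cbfun_bound B; exists C => // v l.
apply: clin_opnorm_le => [|h]; first by rewrite !mulr_ge0.
rewrite (le_trans (BC _ _))// -[leRHS]mulrA ler_wpM2l ?mulr_ge0//.
exact: clin_bound.
Qed.

(** The two halves of the derivative of B(f, g), namely h |-> B(Df h, g) and
    h |-> B(f, Dg h), are again bounded bilinear in (Df, g) and in (f, Dg). *)
Definition cbilinl : cbilin (clin U V) W (clin U Z) :=
  CBilin cbilinl_linearl cbilinl_linearr cbilinl_bound.
Definition cbilinr : cbilin V (clin U W) (clin U Z) :=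
  CBilin cbilinr_linearl cbilinr_linearr cbilinr_bound.

End cbilin_compose.

(** Openness of U matters: the derivatives at a point of U only agree because f
    and g agree near that point. *)
Lemma Ck_ext k V W (U : set V) (f g : V -> W) : open U ->
  (forall x, U x -> f x = g x) -> Ck k U f -> Ck k U g.
Proof.
move=> oU; elim: k W f g => [|k IH] W f g fg /=.
  move=> cf x Ux; have nfg : \near x, f x = g x.
    by move: oU; rewrite openE => /(_ _ Ux); apply: filterS.
  rewrite /prop_for /continuous_at -fg//.
  by apply: cvg_trans (cf x Ux); exact: near_eq_cvg.
move=> [df cDf].
have nfg x : U x -> \near x, f x = g x.
  by move=> Ux; move: oU; rewrite openE => /(_ _ Ux); apply: filterS.
have dg x : U x -> differentiable g x /\ 'd g x = 'd f x :> (V -> W).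
  by move=> Ux; apply: near_differentiable; [exact: nfg|exact: df].
split=> [x Ux|]; first by have [] := dg x Ux.
apply: IH cDf => x Ux; have [dgx e] := dg x Ux.
by apply: Diff_eq => // h; rewrite e; apply: Diff_app; exact: df.
Qed.

Lemma CkS k V W (U : set V) (f : V -> W) : Ck k.+1 U f -> Ck k U f.
Proof.
elim: k W f => [|k IH] W f [df cDf].
  by move=> x Ux; apply/differentiable_continuous/df.
by split=> //; apply: IH.
Qed.

Lemma clinDE V W (l l' : clin V W) h : (l + l') h = l h + l' h.
Proof. by []. Qed.

Lemma CkD k V W (U : set V) (f g : V -> W) : open U ->
  Ck k U f -> Ck k U g -> Ck k U (fun x => f x + g x).
Proof.
move=> oU; elim: k W f g => [|k IH] W f g.
  by move=> cf cg x Ux; apply: cvgD; [exact: cf|exact: cg].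
move=> [df cDf] [dg cDg]; split=> [x Ux|].
  exact: (differentiableD (df x Ux) (dg x Ux)).
apply: (Ck_ext oU _ (IH _ _ _ cDf cDg)) => x Ux.
have dfx := df _ Ux; have dgx := dg _ Ux.
apply: Diff_eq => [|h]; first exact: (differentiableD dfx dgx).
rewrite clinDE.
apply: (eq_trans (congr2 +%R (Diff_app h dfx) (Diff_app h dgx))).
exact: (esym (congr1 (fun l : V -> W => l h) (diffD dfx dgx))).
Qed.

(** By induction on k: D(B(f, g)) is the sum of two bounded bilinear maps
    applied to pairs of maps of class C^k. Working with all bilinear maps at once
    is what makes the induction close, because D(f g) already involves a product
    of another kind. *)
Lemma Ck_cbilin k V W Z (B : cbilin V W Z) (T : normedModType R) (U : set T)
    (f : T -> V) (g : T -> W) : open U ->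
  Ck k U f -> Ck k U g -> Ck k U (fun u => B (f u) (g u)).
Proof.
move=> oU; elim: k V W Z B f g => [|k IH] V W Z B f g cf cg.
  by move=> x Ux; apply: cbilin_cvg; [exact: cf|exact: cg].
have [df cDf] := cf; have [dg cDg] := cg.
split=> [x Ux|]; first by have [] := diff_cbilin B (df x Ux) (dg x Ux).
have cl := IH _ _ _ (@cbilinl T _ _ _ B) _ _ cDf (CkS cg).
have cr := IH _ _ _ (@cbilinr T _ _ _ B) _ _ (CkS cf) cDg.
apply: (Ck_ext oU _ (CkD oU cl cr)) => x Ux.
have [dB eB] := diff_cbilin B (df x Ux) (dg x Ux).
apply: Diff_eq => // h; rewrite eB.
by rewrite clinDE /= (Diff_app h (df x Ux)) (Diff_app h (dg x Ux)).
Qed.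

Lemma scale_cbilin_bound V : exists2 C, 0 <= C &
  forall (a : R^o) (v : V), `|a *: v| <= C * `|a| * `|v|.
Proof. by exists 1 => // a v; rewrite mul1r normrZ. Qed.

Lemma scale_linearl V (v : V) : linear (fun a : R^o => a *: v).
Proof. by move=> a x y; rewrite scalerDl scalerA. Qed.

Lemma scale_linearr V (a : R^o) : linear (fun v : V => a *: v).
Proof. by move=> b x y; rewrite scalerDr !scalerA mulrC. Qed.

Definition scale_cbilin V : cbilin R^o V V :=
  CBilin (@scale_linearl V) (@scale_linearr V) (scale_cbilin_bound V).

Lemma eval_cbilin_bound V W : exists2 C, 0 <= C &
  forall (l : clin V W) (v : V), `|l v| <= C * `|l| * `|v|.
Proof. by exists 1 => // l v; rewrite mul1r clin_bound. Qed.

Lemma eval_linearl V W (v : V) : linear (fun l : clin V W => l v).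
Proof. by []. Qed.

Definition eval_cbilin V W : cbilin (clin V W) V W :=
  CBilin (@eval_linearl V W) (@clin_linear V W) (eval_cbilin_bound V W).

Lemma clin_cvg_at V W (T : Type) (F : set_system T) {FF : Filter F}
    (l : T -> clin V W) (l0 : clin V W) v :
  l @ F --> l0 -> (fun t => l t v) @ F --> l0 v.
Proof.
move=> ll.
exact: (cbilin_cvg (B := eval_cbilin V W) ll (@cvg_cst _ v _ _ _)).
Qed.

(** * Iterated derivatives on one level *)

(** D^k f(x)(v_0, .., v_(k-1)) with v_0 the direction of the first
    differentiation: f' takes its values in a space of linear maps, so v_0 is
    applied last, after differentiating f' along v_1, .., v_(k-1). *)
Fixpoint iterated_diff (k : nat) V W (f : V -> W) (x : V) : ('I_k -> V) -> W :=
  match k return ('I_k -> V) -> W with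
  | 0 => fun=> f x
  | k'.+1 => fun v =>
      iterated_diff (Diff f) x (fun i => v (lift ord0 i)) (v ord0)
  end.

(** Joint continuity, stated along a filter so that the topology put on the
    k-tuples of directions does not intervene. *)
Lemma iterated_diff_cvg k V W (U : set V) (f : V -> W) (T : Type)
    (F : set_system T) {FF : Filter F} (a : T -> V) (v : T -> 'I_k -> V) x w :
  Ck k U f -> U x -> a @ F --> x -> (forall i, v ^~ i @ F --> w i) ->
  (fun t => iterated_diff f (a t) (v t)) @ F --> iterated_diff f x w.
Proof.
move=> + Ux ax; elim: k W f v w => [|k IH] W f v w /=.
  by move=> cf _; apply: continuous_cvg ax; exact: cf.
move=> [_ cDf] vw.
have tail := IH _ (Diff f) (fun t i => v t (lift ord0 i)) _ cDf
  (fun i => vw (lift ord0 i)).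
exact: (cbilin_cvg (B := eval_cbilin V W) tail (vw ord0)).
Qed.

Lemma snoc_tail k V (v : 'I_k.+1 -> V) (h : V) :
  (fun i => snoc v h (lift ord0 i)) = snoc (fun i => v (lift ord0 i)) h.
Proof.
apply/funext => i; rewrite /snoc.
case: (unliftP ord_max i) => [j|] ->.
  have -> : lift ord0 (lift ord_max j) = lift ord_max (lift ord0 j) :> 'I_k.+2.
    by apply/ord_inj; rewrite [LHS]lift0 !lift_max lift0.
  by rewrite liftK.
have -> : lift ord0 ord_max = ord_max :> 'I_k.+2 by apply/val_inj.
by rewrite unlift_none.
Qed.

Lemma snoc0 k V (v : 'I_k.+1 -> V) (h : V) : snoc v h ord0 = v ord0.
Proof.
rewrite /snoc (_ : ord0 = lift ord_max ord0) ?liftK//.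
by apply/ord_inj; rewrite lift_max.
Qed.

(** The recursion peels off the first direction while a new direction is added
    at the end; the two operations commute ([snoc_tail], [snoc0]), so the
    induction hypothesis for f' can be evaluated at the first direction. *)
Lemma iterated_diff_dcvg k V W (U : set V) (f : V -> W) x (v : 'I_k -> V) h :
  Ck k.+1 U f -> U x ->
  (fun t : R => t^-1 *: (iterated_diff f (x + t *: h) v - iterated_diff f x v))
    @ 0^' --> iterated_diff f x (snoc v h).
Proof.
move=> + Ux; elim: k W f v => [|k IH] W f v [df cDf].
  rewrite /= DiffE; last exact: df.
  rewrite /snoc (_ : ord0 = ord_max) ?unlift_none/=; last exact/val_inj.
  by apply: diff_dcvg; exact: df.
have lim_clin := IH _ (Diff f) (fun i => v (lift ord0 i)) cDf.
have -> : iterated_diff f x (snoc v h) =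
    iterated_diff (Diff f) x (snoc (fun i => v (lift ord0 i)) h) (v ord0).
  by rewrite -snoc_tail -(snoc0 v h).
exact: clin_cvg_at lim_clin.
Qed.

End diffs.

Section projective.
Context {R : realType}.

(** * Smoothness on projective limits *)

Lemma prod_cvgP (I : eqType) (K : I -> topologicalType) (T : Type)
    (F : set_system T) {FF : Filter F} (a : T -> prod_topology K)
    (x : prod_topology K) :
  a @ F --> x <-> forall i, (fun t => a t i) @ F --> x i.
Proof.
split=> [ax i|ax].
  have pc : (proj i : prod_topology K -> K i) @ x --> x i.
    exact: proj_continuous.
  exact: (cvg_comp a (proj i : prod_topology K -> K i) ax pc).
apply/cvg_sup => i A /= [_ [[B oB <-] Bx] BA].
by apply: filterS BA _; apply: (ax i); exact: open_nbhs_nbhs.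
Qed.

Lemma subprod_cvgP (S : nat -> normedModType R) (P : set (prod_topology S))
    (hP : submod_closed (mem P)) (T : Type) (F : set_system T)
    {FF : Filter F} (a : T -> subprod hP) (x : subprod hP) :
  a @ F --> x <-> forall i, (fun t => a t i) @ F --> x i.
Proof.
split=> [ax i|ax].
  have : (fun t => spval (a t)) @ F --> spval x.
    have sc : (@spval _ _ _ hP) @ x --> spval x by exact: initial_continuous.
    exact: (cvg_comp a (@spval _ _ _ hP) ax sc).
  by move/prod_cvgP; apply.
have sax : (fun t => spval (a t)) @ F --> spval x by apply/prod_cvgP.
move=> A /= [_ [[B oB <-] Bx] BA].
by apply: filterS BA _; apply: sax; exact: open_nbhs_nbhs.
Qed.

Lemma near0_subprod_line (S : nat -> normedModType R)
    (P : set (prod_topology S)) (hP : submod_closed (mem P))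
    (U : set (subprod hP)) u h : open U -> U u ->
  \forall t \near (0 : R)^', U (u + t *: h).
Proof.
move=> oU Uu; have : (fun t : R => u + t *: h) @ (0 : R) --> u.
  apply/subprod_cvgP => i.
  rewrite -[X in _ --> X]addr0 -(scale0r (h i)).
  by apply: cvgD; [exact: cvg_cst|apply: cvgZr_tmp; exact: cvg_id].
by move=> /(_ U) H; apply: nbhs_dnbhs; apply: H; exact: open_nbhs_nbhs.
Qed.

Section fsmooth.
Context {S : nat -> normedModType R} {P : set (prod_topology S)}.
Variable hP : submod_closed (mem P).

Section level.
Variables (i : nat) (W : normedModType R) (O : set (S i)) (g : S i -> W).
Hypothesis sg : smooth O g.

Definition level_diff k (u : subprod hP) (v : 'I_k -> subprod hP) : W :=
  iterated_diff g (u i) (fun l => v l i).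

Lemma level_diff_continuous k (p : subprod hP * {ptws 'I_k -> subprod hP}) :
  O (p.1 i) ->
  (fun q : subprod hP * {ptws 'I_k -> subprod hP} => level_diff q.1 q.2)
    @ nbhs p --> level_diff p.1 p.2.
Proof.
case: p => u v /= Ou; apply: (iterated_diff_cvg (sg k) Ou) => [|l].
  have : (fun q : subprod hP * {ptws 'I_k -> subprod hP} => q.1)
      @ nbhs (u, v) --> u by exact: cvg_fst.
  by move/subprod_cvgP; apply.
have : (fun q : subprod hP * {ptws 'I_k -> subprod hP} => q.2)
    @ nbhs (u, v) --> v by exact: cvg_snd.
by move/prod_cvgP => /(_ l) /subprod_cvgP; apply.
Qed.

Lemma level_diff_dcvg k (u : subprod hP) (v : 'I_k -> subprod hP) h : O (u i) ->
  (fun t : R => t^-1 *: (level_diff (u + t *: h) v - level_diff u v))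
    @ 0^' --> level_diff u (snoc v h).
Proof.
move=> Ou.
have := iterated_diff_dcvg (v := fun l => v l i) (h := h i) (sg k.+1) Ou.
congr (_ --> iterated_diff _ _ _).
by apply/funext => l; rewrite /snoc; case: unlift.
Qed.

Lemma fsmooth_level (U : set (subprod hP)) (f : subprod hP -> W) :
  (forall u, U u -> O (u i)) -> (forall u, U u -> f u = g (u i)) ->
  fsmooth U f.
Proof.
move=> UO fg; exists level_diff; split=> [u v Uu|k p Up|k u v h Uu].
- by rewrite fg.
- by apply: level_diff_continuous; exact: UO.
- by apply: level_diff_dcvg; exact: UO.
Qed.

End level.

(** The iterated derivatives are taken componentwise. That they lie in Q follows
    by induction on their order: each is a limit of difference quotients of the
    previous one, Q is a closed subspace, and the quotients are formed at points
    of U because U is open. *)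
Lemma fsmooth_subprod (S' : nat -> normedModType R) (Q : set (prod_topology S'))
    (hQ : submod_closed (mem Q)) (U : set (subprod hP)) (O : forall i, set (S i))
    (g : forall i, S i -> S' i) (f : subprod hP -> subprod hQ) :
  open U -> closed Q -> (forall i, smooth (O i) (g i)) ->
  (forall u, U u -> forall i, O i (u i)) ->
  (forall u, U u -> forall i, f u i = g i (u i)) -> fsmooth U f.
Proof.
move=> oU cQ sg UO fg.
pose D k (u : subprod hP) (v : 'I_k -> subprod hP) : prod_topology S' :=
  fun i => level_diff (g i) u v.
have Dcvg k (u : subprod hP) (v : 'I_k -> subprod hP) h : U u ->
    (fun t : R => t^-1 *: (D k (u + t *: h) v - D k u v))
      @ 0^' --> D k.+1 u (snoc v h).
  move=> Uu; apply/prod_cvgP => i.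
  exact: (level_diff_dcvg (v := v) (h := h) (sg i) (UO _ Uu i)).
have snoc_surj k (v : 'I_k.+1 -> subprod hP) :
    exists w h, v = snoc (k := k) w h.
  exists (fun l => v (lift ord_max l)), (v ord_max).
  by apply/funext => l; rewrite /snoc; case: unliftP => [j|] ->.
have Q_quot x y (t : R) : x \in mem Q -> y \in mem Q ->
    t^-1 *: (x - y) \in mem Q.
  move=> xQ yQ; rewrite -[_ *: _]addr0; apply: hQ.2; last exact: hQ.1.
  by rewrite addrC -scaleN1r; exact: hQ.2.
have DQ k (u : subprod hP) (v : 'I_k -> subprod hP) : U u -> D k u v \in mem Q.
  elim: k u v => [|k IH] u v Uu.
    have -> : D 0%N u v = spval (f u).
      by apply: functional_extensionality_dep => i; rewrite -[RHS]/(f u i) fg.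
    by case: (f u).
  have [w [h ->]] := snoc_surj k v.
  have nearQ : \forall t \near (0 : R)^',
      Q (t^-1 *: (D k (u + t *: h) w - D k u w)).
    near=> t; apply/set_mem; apply: Q_quot; apply: IH => //.
    near: t; exact: near0_subprod_line.
  by apply/mem_set; exact: (closed_cvg Q cQ nearQ _ (Dcvg k u w h Uu)).
pose DS k (u : subprod hP) (v : 'I_k -> subprod hP) : subprod hQ :=
  insubd (0 : subprod hQ) (D k u v).
have DSE k u v i : U u -> DS k u v i = D k u v i.
  by move=> Uu; rewrite /spfun -[spval _]/(val _) insubdK//; exact: DQ.
exists DS; split=> [u v Uu|k [u v] /= Uu|k u v h Uu].
- apply/val_inj; apply: functional_extensionality_dep => i.
  by rewrite -[LHS]/(DS 0%N u v i) DSE// -[RHS]/(f u i) fg.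
- apply/subprod_cvgP => i; rewrite DSE//.
  have near_D : \forall q \near (u, v), D k q.1 q.2 i = DS k q.1 q.2 i.
    have q1 : (fun q : subprod hP * {ptws 'I_k -> subprod hP} => q.1)
        @ nbhs (u, v) --> u by exact: cvg_fst.
    near=> q; rewrite DSE//; near: q; apply: q1; exact: open_nbhs_nbhs.
  apply: cvg_trans; first exact: near_eq_cvg near_D.
  exact: (level_diff_continuous (sg i) (p := (u, v)) (UO _ Uu i)).
- apply/subprod_cvgP => i; rewrite DSE//.
  have /prod_cvgP/(_ i) := Dcvg k u v h Uu.
  apply: cvg_trans; apply: near_eq_cvg; near=> t.
  have Ut : U (u + t *: h) by near: t; exact: near0_subprod_line.
  by rewrite -[RHS]/(t^-1 *: (DS k (u + t *: h) v i - DS k u v i)) !DSE.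
Unshelve. all: by end_near. Qed.

End fsmooth.

(** * Directional derivatives of maps that factor through one level *)

Section fderiv.
Context {S : nat -> normedModType R} {P : set (prod_topology S)}.
Variable hP : submod_closed (mem P).
Variables (U : set (subprod hP)) (oU : open U) (i : nat) (g : S i -> R^o).

Lemma fderiv_factor (f : subprod hP -> R) u w :
  (forall z, U z -> f z = g (z i)) -> U u -> differentiable g (u i) ->
  fderiv f u w = 'd g (u i) (w i).
Proof.
move=> fg Uu dg; apply: (@cvg_lim R) => //.
have quot : \forall t \near (0 : R)^',
    t^-1 *: (g (u i + t *: w i) - g (u i)) = t^-1 * (f (u + t *: w) - f u).
  near=> t; have Ut : U (u + t *: w) by near: t; exact: near0_subprod_line.
  by rewrite !fg.
exact: cvg_trans (near_eq_cvg quot) (diff_dcvg dg).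
Unshelve. all: by end_near. Qed.

Lemma fderiv2_factor (f : subprod hP -> R) (O : set (S i)) u x y :
  (forall z, U z -> f z = g (z i)) ->
  (forall z, U z -> O (z i)) -> smooth O g -> U u ->
  fderiv2 f u x y = Diff2 g (u i) (x i) (y i).
Proof.
move=> fg UO sg Uu; have [dg [dDg _]] := sg 2%N.
apply: (@cvg_lim R) => //.
have dgU z : U z -> fderiv f z y = Diff g (z i) (y i).
  by move=> Uz; rewrite DiffE ?fderiv_factor//; apply: dg; exact: UO.
have lim_clin := diff_dcvg (h := x i) (dDg _ (UO _ Uu)).
have quot : \forall t \near (0 : R)^',
    (t^-1 *: (Diff g (u i + t *: x i) - Diff g (u i)) : clin (S i) R^o) (y i) =
    t^-1 * (fderiv f (u + t *: x) y - fderiv f u y).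
  near=> t; have Ut : U (u + t *: x) by near: t; exact: near0_subprod_line.
  by rewrite !dgU.
apply: (cvg_trans (near_eq_cvg quot)).
rewrite /Diff2; apply: (clin_cvg_at (W := R^o)); exact: lim_clin.
Unshelve. all: by end_near. Qed.

End fderiv.

(** * The space H^2(F, F) is closed *)

Lemma cbil_cvg_at (V W : normedModType R) (T : Type) (F : set_system T)
    {FF : Filter F} (f : T -> cbil V W) (b : cbil V W) z :
  f @ F --> b -> (fun t => f t z) @ F --> b z.
Proof.
apply: (@cvg_lipschitz _ _ _ _ _ _ _ _ _ _ (`|z| ^+ 2)) => t; rewrite mulrC.
exact: homog_le (@cbil_homog _ _ _ (f t - b))
  (@cbil_continuous _ _ _ (f t - b)).
Qed.

(** Each compatibility condition is the vanishing of a continuous map, since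
    norm convergence of bilinear maps implies pointwise convergence. *)
Lemma H2_closed (E : banachSystem R) : closed (H2_set (E := E)).
Proof.
move=> B clB i j ij x y; apply/eqP; rewrite -subr_eq0; apply/eqP.
pose d (C : prod_topology (fun i => cbil (E i) (E i))) :=
  C i (rho ij x, rho ij y) - rho ij (C j (x, y)).
have dcvg (F : set_system (prod_topology (fun i => cbil (E i) (E i)))) C :
    Filter F -> F --> C -> d @ F --> d C.
  move=> FF FC; have /prod_cvgP Ccvg : id @ F --> C by exact: FC.
  have rhoC : (fun C' => rho ij (C' j (x, y))) @ F --> rho ij (C j (x, y)).
    apply: (continuous_cvg _ (@rho_continuous _ E _ _ ij _)).
    exact: (cbil_cvg_at (Ccvg j)).
  exact: (cvgB (cbil_cvg_at (Ccvg i)) rhoC).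
have dcont : continuous d.
  by move=> C; apply: dcvg; [exact: nbhs_filter|exact: cvg_id].
have closed0 : closed (d @^-1` [set 0]).
  apply: preimage_closed; first by move=> C _; exact: dcont.
  apply: accessible_closed_set1; apply: hausdorff_accessible.
  exact: norm_hausdorff.
apply: closed0; apply: closure_subset clB => C /= CH.
by rewrite /d CH subrr.
Qed.

(** * Local representatives in a projective limit chart *)

Section manifold.
Context {E : banachSystem R} (M : manifoldSystem E).
Implicit Types (m : limit M) (c : chart_family M).

Lemma smooth_fieldsD i (g : M i -> R) (X Y : forall x : M i, tangent x) :
  smooth_funs g -> smooth_fields X -> smooth_fields Y ->
  smooth_fields (fun x => g x *: X x + Y x).
Proof.
move=> sg sX sY c ac k; apply: CkD; [exact: cimg_open| |exact: sY].
exact: (@Ck_cbilin _ _ _ _ _ (scale_cbilin (E i)) _ _ _ _ (cimg_open c)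
  (sg c ac k) (sX c ac k)).
Qed.

(** The compatibility of the X_i passes to g X + X' because tangent maps are
    linear and g_j(x) = g_i(phi_ji(x)). *)
Lemma is_lim_fieldD gs g Xs X Ys Y : is_lim_fun (M := M) gs g ->
  is_lim_field (M := M) Xs X -> is_lim_field Ys Y ->
  is_lim_field (fun i x => gs i x *: Xs i x + Ys i x)
    (fun m i => g m *: X m i + Y m i).
Proof.
move=> [sg cg gE] [sX cX XE] [sY cY YE]; split.
- by move=> i; exact: smooth_fieldsD.
- move=> i j ij x c1 c2 a1 a2 d1 d2.
  rewrite [LHS]/(gs i (phi ij x) *: Xs i (phi ij x) c2 + Ys i (phi ij x) c2).
  rewrite (cX i j ij x c1)// (cY i j ij x c1)// -cg.
  exact: esym (linearP _ (gs j x) (Xs j x c1) (Ys j x c1)).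
- by move=> m i; rewrite (gE _ i) XE YE.
Qed.

Section local.
Variables (m0 : limit M) (c : chart_family M) (mc : pl_chart_at m0 c).

Lemma lim_invP u : lim_img c u ->
  lim_dom c (lim_inv m0 c u) /\ lim_map c (lim_inv m0 c u) = u.
Proof.
move=> [m cm mu].
pose preim := [set m' | lim_dom c m' /\ lim_map c m' = u].
by apply: (@xgetPex _ m0 preim); exists m.
Qed.

Lemma mproj_lim_inv i u : lim_img c u ->
  mproj i (lim_inv m0 c u) = cinv (c i) (u i).
Proof.
move=> /lim_invP[cm um]; rewrite -{2}um (lim_mapE _ mc cm) cmapK//; exact: cm.
Qed.

Lemma lim_img_proj i u : lim_img c u -> cimg (c i) (u i).
Proof.
move=> [m cm <-]; exists (mproj i m); first exact: cm.
by rewrite (lim_mapE _ mc).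
Qed.

Lemma lim_fun_local fs f i u : is_lim_fun fs f -> lim_img c u ->
  (f \o lim_inv m0 c) u = fs i (cinv (c i) (u i)).
Proof. by move=> [_ _ fE] cu; rewrite /= (fE _ i) mproj_lim_inv. Qed.

(** In the charts c_j and c_i the connecting map phi_ji is the linear map rho_ji,
    so that its tangent map is rho_ji as well. *)
Lemma lim_field_local Xs X m : is_lim_field Xs X -> lim_dom c m ->
  ((fun i => X m i (c i)) : prod_topology (fun i => E i))
    \in mem (frechet_set (E := E)).
Proof.
move=> [sX cX XE] cm; rewrite inE => i j ij /=; rewrite !XE.
have phim : phi ij (mproj j m) = mproj i m by have /set_mem -> := valP m.
have [ac cphi _ _] := mc.
have [di ci] := cphi i j ij _ (cm j).
have := cX i j ij (mproj j m) (c j) (c i) (ac j).1 (ac i).1 (cm j) di.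
rewrite phim => ->.
have nrho : \forall u \near cmap (c j) (mproj j m),
   rho ij u = (cmap (c i) \o phi ij \o cinv (c j)) u.
  have : nbhs (cmap (c j) (mproj j m)) (cimg (c j)).
    by apply: open_nbhs_nbhs; split; [exact: cimg_open|exists (mproj j m)].
  apply: filterS => _ [x cx <-]; rewrite /= cmapK//.
  by have [_ ->] := cphi i j ij _ cx.
have [_ ->] := near_differentiable nrho
  (linear_differentiable _ (@rho_continuous _ _ _ _ ij)).
by rewrite diff_lin//; exact: rho_continuous.
Qed.

Lemma lim_field_localE Xs X m i : is_lim_field Xs X -> lim_dom c m ->
  (insubd (0 : frechet E) (fun i => X m i (c i))) i = X m i (c i).
Proof.
move=> hX cm; rewrite /spfun -[spval _]/(val _) insubdK//.
exact: (lim_field_local hX cm).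
Qed.

(** The left-hand side depends on i and on the systems (f_i), (X_i), (Y_i); the
    right-hand side depends only on their limits. *)
Lemma hessian_local (H : forall i, hessian_map (M i))
    (Gs : forall i, E i -> cbil (E i) (E i)) (G : frechet E -> H2 E)
    fs f Xs X Ys Y m i :
  is_christoffel (H i) (c i) (Gs i) ->
  (forall u, lim_img c u -> G u i = Gs i (u i)) ->
  is_lim_fun fs f -> is_lim_field Xs X -> is_lim_field Ys Y ->
  lim_dom c m ->
  let u := lim_map c m in
  let fc := f \o lim_inv m0 c in
  let Xu := insubd (0 : frechet E) (fun i => X m i (c i)) in
  let Yu := insubd (0 : frechet E) (fun i => Y m i (c i)) in
  H i (fs i) (Xs i) (Ys i) (mproj i m) =
    fderiv2 fc u Xu Yu + fderiv fc u (H2_app (G u) Xu Yu).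
Proof.
move=> [sG hG] GE hf hX hY cm u fc Xu Yu.
have [ac cphi odom oimg] := mc.
have cu : lim_img c u by exists m.
have [sf _ _] := hf; have [sX _ XE] := hX; have [sY _ YE] := hY.
have sfc : smooth (cimg (c i)) ((fs i : M i -> R^o) \o cinv (c i)).
  by apply: sf; exact: (ac i).1.
have fcE z : lim_img c z -> fc z = ((fs i : M i -> R^o) \o cinv (c i)) (z i).
  by move=> cz; exact: lim_fun_local hf cz.
rewrite (hG _ _ _ (sf i) (sX i) (sY i) _ (cm i)).
rewrite (fderiv2_factor oimg _ _ fcE (@lim_img_proj i) sfc cu).
rewrite (fderiv_factor oimg _ fcE cu); last first.
  by have [+ _] := sfc 1%N; apply; exact: lim_img_proj.
rewrite [H2_app _ _ _ i]/(G u i (Xu i, Yu i)) GE// /Xu /Yu.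
rewrite (lim_field_localE _ hX cm) (lim_field_localE _ hY cm) !XE !YE.
by rewrite (lim_mapE _ mc cm).
Qed.

End local.

(** * The limit of a system of Hessian structures *)

Section system.
Variable H : forall i : nat, hessian_map (M i).
Hypothesis HH : hessian_system H.
Arguments H : clear implicits.

(** The compatibility of the Gamma_i is known on the images of the charts only,
    so Gamma is set to 0 outside the image of the limit chart. *)
Lemma lim_christoffel_exists m c : pl_chart_at m c ->
  exists (Gs : forall i, E i -> cbil (E i) (E i)) (G : frechet E -> H2 E),
  [/\ forall i, is_christoffel (H i) (c i) (Gs i), christoffel_compatible c Gs &
      forall u, lim_img c u -> forall i, G u i = Gs i (u i)].
Proof.
move=> mc; have [_ /(_ m c mc) [Gs cG compG]] := HH.
exists Gs, (fun u => insubd (0 : H2 E) (fun i => Gs i (u i))); split=> // u cu i.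
rewrite /spfun -[spval _]/(val _) insubdK// inE => j k jk x y.
have urho : rho jk (u k) = u j.
  by case: u {cu} => u /= /[!inE] hu; rewrite /spfun /= hu.
by rewrite compG ?urho//; exact: (lim_img_proj mc).
Qed.

Lemma lim_hessian_well_defined fs fs' f Xs Xs' X Ys Ys' Y m i i' :
  has_pl_charts M ->
  is_lim_fun fs f -> is_lim_field Xs X -> is_lim_field Ys Y ->
  is_lim_fun fs' f -> is_lim_field Xs' X -> is_lim_field Ys' Y ->
  H i (fs i) (Xs i) (Ys i) (mproj i m) =
    H i' (fs' i') (Xs' i') (Ys' i') (mproj i' m).
Proof.
move=> /(_ m) [c mc] hf hX hY hf' hX' hY'.
have [Gs [G [cG _ GE]]] := lim_christoffel_exists mc.
have cm : lim_dom c m by have [ac _ _ _] := mc; move=> j; exact: (ac j).2.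
rewrite (hessian_local mc (cG i) (fun u cu => GE u cu i) hf hX hY cm).
by rewrite (hessian_local mc (cG i') (fun u cu => GE u cu i') hf' hX' hY' cm).
Qed.

End system.

End manifold.

End projective.

Theorem proposition3p4 (R : realType) (E : banachSystem R)
    (M : manifoldSystem E) (Mcharts : has_pl_charts M)
    (H : forall i : nat, hessian_map (M i)) (HH : hessian_system H) :
  (exists K : lim_hessian_map M, is_lim_hessian H K) /\
  (forall K : lim_hessian_map M,
    is_lim_hessian H K -> lim_hessian_structure K).
Proof.
split.
  (* any level would do; the value 0 is taken when f, X or Y is not a limit *)
  pose values f X Y m := [set r : R | exists fs Xs Ys,
    [/\ is_lim_fun fs f, is_lim_field Xs X, is_lim_field Ys Y &
        r = H 0%N (fs 0%N) (Xs 0%N) (Ys 0%N) (mproj 0%N m)]].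
  exists (fun f X Y m => xget 0 (values f X Y m)) => fs f Xs X Ys Y hf hX hY m i.
  have /xgetPex : values f X Y m !=set0.
    exists (H 0%N (fs 0%N) (Xs 0%N) (Ys 0%N) (mproj 0%N m)).
    by exists fs, Xs, Ys; split.
  move=> /(_ 0) [fs' [Xs' [Ys' [hf' hX' hY' ->]]]].
  exact: (lim_hessian_well_defined HH m 0%N i Mcharts hf' hX' hY' hf hX hY).
move=> K KH; have [Hs _] := HH; split.
  move=> f [fs hf]; have tH i : tensor2 (H i (fs i)).
    by apply: (Hs i).1; have [] := hf.
  split.
  - move=> X Y [Xs hX] [Ys hY] m c mc.
    have [sT _ _] := tH 0%N; have [sX _ _] := hX; have [sY _ _] := hY.
    have [ac _ odom oimg] := mc.
    have sT0 := sT _ _ (sX 0%N) (sY 0%N) _ (ac 0%N).1.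
    have KT u : lim_img c u -> (K f X Y \o lim_inv m c) u =
        H 0%N (fs 0%N) (Xs 0%N) (Ys 0%N) (cinv (c 0%N) (u 0%N)).
      move=> cu; rewrite /= (KH _ _ _ _ _ _ hf hX hY _ 0%N).
      by rewrite (mproj_lim_inv mc).
    exact: (fsmooth_level sT0 (@lim_img_proj _ _ _ _ _ mc 0%N) KT).
  - move=> g X X' Y [gs hg] [Xs hX] [Xs' hX'] [Ys hY]; apply/funext => m.
    have hXX := is_lim_fieldD hg hX hX'.
    rewrite (KH _ _ _ _ _ _ hf hXX hY m 0%N) (KH _ _ _ _ _ _ hf hX hY m 0%N).
    rewrite (KH _ _ _ _ _ _ hf hX' hY m 0%N).
    have [sg _ gE] := hg; have [sX _ _] := hX; have [sX' _ _] := hX'.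
    have [sY _ _] := hY; have [_ tl _] := tH 0%N.
    by rewrite (tl _ _ _ _ (sg 0%N) (sX 0%N) (sX' 0%N) (sY 0%N)) (gE _ 0%N).
  - move=> g X Y Y' [gs hg] [Xs hX] [Ys hY] [Ys' hY']; apply/funext => m.
    have hYY := is_lim_fieldD hg hY hY'.
    rewrite (KH _ _ _ _ _ _ hf hX hYY m 0%N) (KH _ _ _ _ _ _ hf hX hY m 0%N).
    rewrite (KH _ _ _ _ _ _ hf hX hY' m 0%N).
    have [sg _ gE] := hg; have [sX _ _] := hX; have [sY' _ _] := hY'.
    have [sY _ _] := hY; have [_ _ tr] := tH 0%N.
    by rewrite (tr _ _ _ _ (sg 0%N) (sX 0%N) (sY 0%N) (sY' 0%N)) (gE _ 0%N).
move=> m c mc; have [Gs [G [cG compG GE]]] := lim_christoffel_exists HH mc.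
exists G; split.
- by exists Gs; split => // i; have [] := cG i.
- have [_ _ _ oimg] := mc.
  apply: (fsmooth_subprod oimg (@H2_closed _ E)
    (O := fun i => cimg (c i)) (g := Gs)).
  + by move=> i; have [] := cG i.
  + by move=> u cu i; exact: (lim_img_proj mc).
  + exact: GE.
- move=> f X Y [fs hf] [Xs hX] [Ys hY] m' cm' u fc Xu Yu.
  rewrite (KH _ _ _ _ _ _ hf hX hY m' 0%N).
  exact: (hessian_local mc (cG 0%N) (fun u cu => GE u cu 0%N) hf hX hY cm').
Qed.
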